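(* Let $G=(V,E)$ be a graph which is an $n$-convex geometry with no star. Let $\mathcal{D}=\{x\in V:d(x)=|V|-2\}$ be the set of quasi-stars of $G$, and let $\operatorname{Max}(V)$ be the set of maximal elements of the neighbourhood poset $P(G)=(V,\leq)$, where $x\leq y$ if and only if $N[x]\subseteq N[y]$. Then $\mathcal{D}=\operatorname{Max}(V)$.
   Context: All graphs are finite, simple and undirected, with non-empty vertex set. $d(x)$ denotes the degree of the vertex $x$. For a graph $G=(V,E)$ and $x\in V$, the closed neighbourhood of $x$ is $N[x]=\{x\}\cup\{y\in V:\{x,y\}\in E\}$. A star of $G$ is a vertex $s$ with $N[s]=V$. For $Y\subseteq V$, the common closed neighbourhood is $N[Y]=\bigcap_{y\in Y}N[y]$ if $Y\neq\varnothing$, and $N[\varnothing]=V$. The neighbourhood convexity of $G$ is the family $n_G=\{N[Y]:Y\subseteq V\}\cup\{\varnothing\}$ of subsets of $V$; it contains $\varnothing$ and $V$ and is closed under intersection. Its members are called $n$-convex sets. For $X\subseteq V$ the convex hull $[X]_{n}$ is the intersection of all $n$-convex sets containing $X$. For an $n$-convex set $K$, $\operatorname{ex}(K)=\{x\in K: K\setminus\{x\}\in n_G\}$ is the set of extreme points of $K$. $G$ is an $n$-convex geometry if $K=[\operatorname{ex}(K)]_{n}$ for every $n$-convex set $K$. An element $x$ of $(V,\leq)$ is maximal if, for every $y\in V$, $x\leq y$ implies $y\leq x$. (The relation $\leq$ is in general a preorder; for an $n$-convex geometry it is a partial order.) *)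

(* Defs.v *)
From mathcomp Require Import all_boot.

Set Implicit Arguments.
Unset Strict Implicit.
Unset Printing Implicit Defensive.

(* A simple graph on V is an edge relation e, assumed symmetric and
   irreflexive in the theorem. *)
Section NeighbourhoodConvexity.

Variables (V : finType) (e : rel V).

Definition degree (x : V) : nat := #|[set y | e x y]|.

Definition cl_nbh (x : V) : {set V} := x |: [set y | e x y].

Definition star (s : V) : bool := cl_nbh s == [set: V].

(* The intersection over the empty family is [set: V]. *)
Definition common_nbh (Y : {set V}) : {set V} := \bigcap_(y in Y) cl_nbh y.

Definition nconvexity : {set {set V}} :=
  set0 |: [set common_nbh Y | Y : {set V}].

Definition nhull (X : {set V}) : {set V} :=
  \bigcap_(K in nconvexity | X \subset K) K.

Definition extreme (K : {set V}) : {set V} :=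
  [set x in K | K :\ x \in nconvexity].

Definition nconvex_geometry : Prop :=
  forall K : {set V}, K \in nconvexity -> K = nhull (extreme K).

Definition nbh_le : rel V := fun x y => cl_nbh x \subset cl_nbh y.

Definition nbh_max : {set V} :=
  [set x | [forall y, nbh_le x y ==> nbh_le y x]].

(* Written without subtraction, since nat subtraction truncates at 0. *)
Definition quasi_stars : {set V} := [set x | degree x + 2 == #|V|].

End NeighbourhoodConvexity.

(* Main.v *)
(* Applied to K = V, the geometry property says that no closed neighbourhood
   other than V contains ex(V).  So a maximal m misses some x in ex(V); as
   V \ {x} is convex, it lies in some N[q], whence N[m] <= V \ {x} <= N[q], and
   maximality forces N[m] = V \ {x}. *)
Require Import Defs.
From mathcomp Require Import all_boot.

Lemma card_cl_nbh {V : finType} {e : rel V} (e_irr : irreflexive e) (x : V) :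
  #|cl_nbh e x| = (degree e x).+1.
Proof. by rewrite /cl_nbh cardsU1 inE e_irr. Qed.

Lemma cl_nbh_refl {V : finType} (e : rel V) (x : V) : x \in cl_nbh e x.
Proof. exact: setU11. Qed.

Lemma cl_nbh_nconvex {V : finType} (e : rel V) (x : V) :
  cl_nbh e x \in nconvexity e.
Proof.
apply/setUP; right; apply/imsetP; exists [set x] => //.
by rewrite /common_nbh big_set1.
Qed.

Lemma setT_nconvex {V : finType} (e : rel V) : [set: V] \in nconvexity e.
Proof.
apply/setUP; right; apply/imsetP; exists set0 => //.
by rewrite /common_nbh big_set0.
Qed.

(** Such a [K] is the common neighbourhood of some [Y], and [Y] is nonempty because the empty family
    yields all of [V]; any member of [Y] serves as [y]. *)
Lemma nconvex_sub_cl_nbh {V : finType} {e : rel V} {K : {set V}} :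
  K \in nconvexity e -> K != set0 -> K != setT ->
  exists y, K \subset cl_nbh e y.
Proof.
case/setUP=> [/set1P-> | /imsetP[Y _ ->] _]; first by rewrite eqxx.
have [->|[y yY] _] := set_0Vmem Y; first by rewrite /common_nbh big_set0 eqxx.
by exists y; apply: bigcap_inf.
Qed.

Lemma not_star_card {V : finType} {e : rel V} {x : V} :
  ~~ star e x -> #|cl_nbh e x| < #|V|.
Proof. by move=> nst; rewrite -cardsT proper_card // properT. Qed.

(** [cl_nbh e m] is itself convex, so if it contained the extreme points of [V] it would contain
    their hull, which is [V]. *)
Lemma extreme_setT_not_sub {V : finType} {e : rel V} {m : V} :
  nconvex_geometry e -> ~~ star e m ->
  ~~ (extreme e [set: V] \subset cl_nbh e m).
Proof.
move=> geom; apply: contraNN => sub.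
rewrite /star -subTset {1}(geom _ (setT_nconvex e)).
by apply: bigcap_inf; rewrite cl_nbh_nconvex.
Qed.

Theorem proposition30 (V : finType) (e : rel V)
    (e_sym : symmetric e) (e_irr : irreflexive e) (V_nonempty : 0 < #|V|)
    (geom : nconvex_geometry e)
    (no_star : ~ exists s : V, star e s) :
  quasi_stars e = nbh_max e.
Proof.
have nst s : ~~ star e s by apply/negP => st; apply: no_star; exists s.
apply/setP => m; rewrite !inE.
(* Since [m] is not a star, its closed neighbourhood, of size [degree e m + 1], misses at least one
   vertex; only the lower bound on its size remains. *)
have -> : (degree e m + 2 == #|V|) = (#|V| <= #|cl_nbh e m|.+1).
  by rewrite eqn_leq addn2 -(card_cl_nbh e_irr) not_star_card.
apply/idP/forallP => [cardm y | maxm].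
  rewrite /nbh_le; apply/implyP => le_my.
  (* The larger set [cl_nbh e y] also misses a vertex, so it has at most [#|V| - 1] elements, a size
     that [cl_nbh e m] already attains. *)
  have/eqP eq_my : cl_nbh e m == cl_nbh e y.
    by rewrite eqEcard le_my -ltnS (leq_trans (not_star_card (nst y))).
  by rewrite eq_my.
have/subsetPn[x] := extreme_setT_not_sub geom (nst m).
rewrite inE => /andP[_ cvx] xm.
have sub_mx : cl_nbh e m \subset [set: V] :\ x by rewrite subsetD1 subsetT.
(* The complement of [x] is nonempty because it contains [m], and proper because it omits [x]. *)
have [||q sub_xq] := nconvex_sub_cl_nbh cvx.
- by apply/set0Pn; exists m; apply: (subsetP sub_mx); apply: cl_nbh_refl.
- by apply/eqP => /setP/(_ x); rewrite !inE eqxx.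
have le_mq : nbh_le e m q := subset_trans sub_mx sub_xq.
have le_qm : cl_nbh e q \subset cl_nbh e m := implyP (maxm q) le_mq.
by rewrite -cardsT (cardsD1 x) inE ltnS subset_leq_card ?(subset_trans sub_xq).
Qed.
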